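(* Let $n$, $k$ and $l$ be integers with $1\leq k<l\leq n-1$ and $k+l\leq n$, and let $G(n,k,l)$ be the set-inclusion graph. Then $$\mathrm{Aut}(G(n,k,l))\cong \begin{cases} S_n& \text{if } k+l<n,\\ S_n\times \mathbb{Z}_2 & \text{if } k+l=n, \end{cases} $$ where $S_n$ is the symmetric group on $[n]$ and $\mathbb{Z}_2$ is the cyclic group of order $2$.
   Context: For integers $1\leq k<l\leq n-1$, the set-inclusion graph $G(n,k,l)$ is the simple graph whose vertex set consists of all $k$-subsets and all $l$-subsets of $[n]=\{1,\dots,n\}$, two distinct vertices being adjacent iff one of them is contained in the other. $\mathrm{Aut}(G)$ denotes the group of all permutations of the vertex set preserving adjacency. *)

(* Defs.v *)
From HB Require Import structures.
From mathcomp Require Import all_boot all_algebra all_fingroup.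

Set Implicit Arguments.
Unset Strict Implicit.
Unset Printing Implicit Defensive.

Import GroupScope.

Section GraphAut.

Variables (T : finType) (e : rel T).

Definition graph_aut : {set {perm T}} :=
  [set s : {perm T} | [forall x, forall y, e (s x) (s y) == e x y]].

Lemma graph_autP (s : {perm T}) :
  reflect (forall x y, e (s x) (s y) = e x y) (s \in graph_aut).
Proof.
rewrite inE; apply: (iffP forallP) => [H x y|H x].
  by move/forallP: (H x) => /(_ y)/eqP.
by apply/forallP => y; rewrite H.
Qed.

Lemma graph_aut_group_set : group_set graph_aut.
Proof.
apply/group_setP; split=> [|s t /graph_autP Hs /graph_autP Ht].
  by apply/graph_autP => x y; rewrite !perm1.
by apply/graph_autP => x y; rewrite !permM Ht Hs.
Qed.

Canonical graph_aut_group : {group {perm T}} := Group graph_aut_group_set.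

End GraphAut.

(* The ground set [n] = {1, ..., n} is represented by 'I_n = {0, ..., n-1}. *)
Definition inclusion_vertex (n k l : nat) : finType :=
  {A : {set 'I_n} | (#|A| == k) || (#|A| == l)}.

Definition inclusion_graph (n k l : nat) : rel (inclusion_vertex n k l) :=
  fun A B => (A != B) && ((val A \subset val B) || (val B \subset val A)).

Lemma inclusion_graph_sym n k l : symmetric (@inclusion_graph n k l).
Proof. by move=> A B; rewrite /inclusion_graph eq_sym orbC. Qed.

Lemma inclusion_graph_irr n k l : irreflexive (@inclusion_graph n k l).
Proof. by move=> A; rewrite /inclusion_graph eqxx. Qed.

(* Main.v *)
(** A map on subsets that preserves cardinality and inclusion between the k-sets and the
    l-sets preserves, for every family of k-sets, the number of l-sets containing all of
    its members, a number that determines the size of the union as long as that size is at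
    most l.  Hence it recognizes which k-sets meet in k-1 points, and distinguishes the
    triples of such sets sharing a (k-1)-set from those lying in a (k+1)-set.  So it induces
    a map of the (k-1)-sets that preserves inclusion into the k-sets, and by descent to
    k = 1 it comes from a permutation of the ground set.  An automorphism of the graph either
    preserves or swaps the two parts; it preserves them when k + l < n because vertex degrees
    differ, and when k + l = n the swapping ones become part-preserving after composition
    with complementation, a central involution. *)

Require Import Defs.
From mathcomp Require Import all_boot all_algebra all_fingroup.
From mathcomp Require Import zify.

Set Implicit Arguments.
Unset Strict Implicit.
Unset Printing Implicit Defensive.

(** * Counting the supersets of a given size *)

Lemma ltn_bin2l m p r : 0 < r <= p -> m < p -> 'C(m, r) < 'C(p, r).
Proof.
case: r p => [|r] [|p] //= le_rp; rewrite ltnS => le_mp.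
have := leq_bin2l r.+1 le_mp; have: 0 < 'C(p, r) by rewrite bin_gt0.
by rewrite binS; lia.
Qed.

Lemma exists_set_between (T : finType) (U W : {set T}) m :
  U \subset W -> #|U| <= m <= #|W| ->
  exists B : {set T}, [/\ #|B| = m, U \subset B & B \subset W].
Proof.
move=> sUW /andP[leUm lemW].
have: 0 < #|[set A : {set T} | A \subset W :\: U & #|A| == m - #|U|]|.
  by rewrite cards_draws bin_gt0 cardsDS // leq_sub2r.
case/card_gt0P=> A; rewrite inE => /andP[]; rewrite subsetD => /andP[sAW dAU] /eqP cA.
exists (U :|: A); split; rewrite ?subsetUl ?subUset ?sUW //.
rewrite cardsU (_ : U :&: A = set0) ?cards0 ?subn0 ?cA ?subnKC //.
by apply/eqP; rewrite setI_eq0 disjoint_sym.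
Qed.

Definition supersets (T : finType) (l : nat) (U : {set T}) :=
  [set B : {set T} | (#|B| == l) && (U \subset B)].

(** Complements of the [l]-supersets of [U] are the subsets of [~: U] of size [#|T| - l]. In this
    form the count is correctly zero when [U] has more than [l] points. *)
Lemma card_supersets (T : finType) l (U : {set T}) :
  l <= #|T| -> #|supersets l U| = 'C(#|T| - #|U|, #|T| - l).
Proof.
move=> le_lT; have <- : #|~: U| = #|T| - #|U| by rewrite cardsCs setCK.
rewrite -cards_draws -(card_imset _ (@setC_inj T)).
apply: eq_card => B; apply/imsetP/idP => [[A + ->]|]; rewrite !inE.
  by case/andP=> /eqP cA sUA; rewrite setCS sUA cardsCs setCK cA eqxx.
move=> /andP[sB /eqP cB]; exists (~: B); rewrite ?setCK //.
by rewrite inE subsetC sB cardsCs setCK cB subKn ?eqxx.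
Qed.

(** The bound on [#|U|] makes the count nonzero, where the binomial is strictly monotone in its
    upper argument; hence [W] needs no bound of its own. *)
Lemma card_supersets_inj (T : finType) l (U W : {set T}) :
  l < #|T| -> #|U| <= l -> #|supersets l U| = #|supersets l W| -> #|U| = #|W|.
Proof.
move=> lt_lT leUl; rewrite !card_supersets ?(ltnW lt_lT) // => eqC.
have [le_U le_W] := (max_card (mem U), max_card (mem W)).
have lt_bin := @ltn_bin2l _ _ (#|T| - l).
have [ltUW|ltWU|//] := ltngtP #|U| #|W|.
  by have := lt_bin (#|T| - #|W|) (#|T| - #|U|); rewrite eqC ltnn; lia.
by have := lt_bin (#|T| - #|U|) (#|T| - #|W|); rewrite eqC ltnn; lia.
Qed.

(** * Inclusion-preserving maps and the descent from k to k-1 *)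

Definition inclusion_preserving (T : finType) k l (f : {set T} -> {set T}) :=
  [/\ forall A : {set T}, #|A| = k -> #|f A| = k,
      forall B : {set T}, #|B| = l -> #|f B| = l
    & forall A B : {set T}, #|A| = k -> #|B| = l -> (f A \subset f B) = (A \subset B)].

(** Since [Z] is not inside [X :|: Y], its trace there has at most k-1 points. The traces on [X] and
    on [Y] already have k-1, so all three agree and equal [X :&: Y]. *)
Lemma sunflower_core (T : finType) k (X Y Z : {set T}) :
  #|X| = k -> #|Y| = k -> #|Z| = k -> #|X :|: Y| = k.+1 -> #|X :|: Z| = k.+1 ->
  #|Y :|: Z| = k.+1 -> #|X :|: Y :|: Z| != k.+1 -> X :&: Y \subset Z.
Proof.
move=> cX cY cZ cXY cXZ cYZ nXYZ.
have cI (P Q : {set T}) : #|P| = k -> #|Q| = k -> #|P :|: Q| = k.+1 -> #|P :&: Q|.+1 = k.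
  by move=> cP cQ; have := cardsUI P Q; lia.
have ltZ : #|Z :&: (X :|: Y)| < k.
  rewrite -cZ proper_card // properEneq subsetIl andbT.
  by apply: contra_neq nXYZ => /setIidPl/setUidPl->.
have eqI (P : {set T}) : #|P| = k -> #|P :|: Z| = k.+1 -> P \subset X :|: Y -> Z :&: P = Z :&: (X :|: Y).
  move=> cP cPZ sP; apply/eqP; rewrite eqEcard setIS //= -ltnS.
  by rewrite [Z :&: P]setIC (cI _ _ cP cZ cPZ).
have eqX := eqI X cX cXZ (subsetUl _ _).
have eqY := eqI Y cY cYZ (subsetUr _ _).
have -> : X :&: Y = Z :&: X; last exact: subsetIl.
apply/esym/eqP; rewrite eqEcard subsetI subsetIr {1}eqX -eqY subsetIr /=.
by rewrite -ltnS (cI _ _ cX cY cXY) [Z :&: X]setIC (cI _ _ cX cZ cXZ).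
Qed.

Section InclusionPreserving.

Variables (T : finType) (k l : nat) (f : {set T} -> {set T}).
Hypotheses (lt_kl : k < l) (lt_lT : l < #|T|).
Hypothesis fP : inclusion_preserving k l f.

Let card_lower (A : {set T}) : #|A| = k -> #|f A| = k. Proof. by case: fP => + _ _; apply. Qed.
Let card_upper (B : {set T}) : #|B| = l -> #|f B| = l. Proof. by case: fP => _ + _; apply. Qed.
Let f_sub (A B : {set T}) : #|A| = k -> #|B| = l -> (f A \subset f B) = (A \subset B).
Proof. by case: fP => _ _; apply. Qed.

(** A point of [A'] outside [A] would be avoided by some [l]-set containing [A], yet that [l]-set
    must also contain [A']. *)
Lemma inclusion_preserving_inj_lower (A A' : {set T}) : #|A| = k -> #|A'| = k -> f A = f A' -> A = A'.
Proof.
move=> cA cA' eqf; apply/esym/eqP; rewrite eqEcard cA cA' leqnn andbT.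
apply/subsetP=> x; apply: contraTT => nAx.
have [||B [cB sAB sBx]] := @exists_set_between T A [set~ x] l.
- by apply/subsetP=> y Ay; rewrite !inE; apply: contraNneq nAx => <-.
- by rewrite cA cardsC1 ltnW //= -ltnS (ltn_predK lt_lT).
have: A' \subset B by rewrite -f_sub // -eqf f_sub.
move/subsetP/(_ x)=> sA'B; apply/negP=> /sA'B /(subsetP sBx).
by rewrite !inE eqxx.
Qed.

Hypothesis k_gt0 : 0 < k.

Lemma exists_lower x (B : {set T}) : #|B| = l -> x \in B ->
  exists A : {set T}, [/\ #|A| = k, x \in A & A \subset B].
Proof.
move=> cB Bx; have [||A [cA sxA sAB]] := @exists_set_between T [set x] B k.
- by rewrite sub1set.
- by rewrite cards1 k_gt0 cB ltnW.
by exists A; rewrite -sub1set.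
Qed.

(** An [l]-set is the union of its [k]-subsets, and those are read off from [f B]. *)
Lemma inclusion_preserving_inj_upper (B B' : {set T}) : #|B| = l -> #|B'| = l -> f B = f B' -> B = B'.
Proof.
move=> cB cB' eqf; apply/eqP; rewrite eqEcard cB cB' leqnn andbT.
apply/subsetP=> x /(exists_lower cB)[A [cA Ax sAB]].
by apply: subsetP Ax; rewrite -f_sub // -eqf f_sub.
Qed.

(** Being injective on the finite family of [l]-sets, [f] permutes it, so it matches the common
    [l]-supersets of three [k]-sets with those of their images. *)
Lemma card_supersets_triple (A1 A2 A3 : {set T}) : #|A1| = k -> #|A2| = k -> #|A3| = k ->
  #|supersets l (f A1 :|: f A2 :|: f A3)| = #|supersets l (A1 :|: A2 :|: A3)|.
Proof.
move=> c1 c2 c3; set K := [set B : {set T} | #|B| == l].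
have injK : {in K &, injective f}.
  by move=> B B'; rewrite !inE => /eqP cB /eqP cB'; apply: inclusion_preserving_inj_upper.
have fK : f @: K = K.
  apply/eqP; rewrite eqEcard card_in_imset // leqnn andbT.
  by apply/subsetP=> _ /imsetP[B + ->]; rewrite !inE => /eqP/card_upper->.
have <- : f @: supersets l (A1 :|: A2 :|: A3) = supersets l (f A1 :|: f A2 :|: f A3).
  apply/setP=> C; apply/imsetP/idP => [[B + ->]|].
    rewrite !inE !subUset => /andP[/eqP cB].
    by rewrite card_upper // !f_sub // eqxx.
  rewrite inE => /andP[cC sC]; have: C \in f @: K by rewrite fK inE.
  case/imsetP=> B; rewrite inE => /eqP cB eC; exists B => //.
  by move: sC; rewrite eC !inE !subUset cB eqxx !f_sub.
rewrite card_in_imset // => B B'; rewrite !inE => /andP[+ _] /andP[+ _].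
by move=> /eqP cB /eqP cB'; apply: inclusion_preserving_inj_upper.
Qed.

(** As k+1 is at most [l], equal superset counts force equal sizes once either union has k+1
    points. *)
Lemma card_union_lower (A1 A2 A3 : {set T}) : #|A1| = k -> #|A2| = k -> #|A3| = k ->
  (#|f A1 :|: f A2 :|: f A3| == k.+1) = (#|A1 :|: A2 :|: A3| == k.+1).
Proof.
move=> c1 c2 c3; have E := card_supersets_triple c1 c2 c3.
apply/eqP/eqP=> cU; rewrite -cU; last apply: esym.
  by apply/esym/(card_supersets_inj lt_lT _ E); rewrite cU.
by apply: (card_supersets_inj lt_lT _ (esym E)); rewrite cU.
Qed.

(* C is the common intersection of the images of the k-sets containing S. *)
Lemma exists_core (S : {set T}) : #|S|.+1 = k -> exists C : {set T},
  #|C|.+1 = k /\ forall A : {set T}, #|A| = k -> (C \subset f A) = (S \subset A).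
Proof.
move=> cS.
have cSx x : x \notin S -> #|x |: S| = k by move=> Sx; rewrite cardsU1 Sx add1n.
have: 1 < #|~: S| by have := cardsC S; lia.
case/card_gt1P=> a [b []]; rewrite !inE => Sa Sb neq_ab.
have cU x y : x \notin S -> y \notin S -> x != y -> #|f (x |: S) :|: f (y |: S)| = k.+1.
  move=> Sx Sy neq_xy; have [cx cy] := (cSx x Sx, cSx y Sy).
  (* A pair is treated as a triple with a repeated member. *)
  rewrite -[f (x |: S)]setUid; apply/eqP; rewrite card_union_lower // setUid.
  by rewrite -setUUl -setUA cardsU1 !inE negb_or Sx neq_xy cy.
pose C := f (a |: S) :&: f (b |: S); exists C.
have cC : #|C|.+1 = k.
  by have := cardsUI (f (a |: S)) (f (b |: S)); rewrite cU // !card_lower ?cSx // -/C; lia.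
have sub_C (A : {set T}) : #|A| = k -> S \subset A -> C \subset f A.
  move=> cA sSA; have /cards1P[c defc]: #|A :\: S| == 1 by rewrite cardsDS // cA -cS subSnn.
  have Sc : c \notin S by move/setP/(_ c): (defc); rewrite !inE eqxx => /andP[].
  have -> : A = c |: S by rewrite -defc setUC -{1}(setID A S) (setIidPr sSA).
  have [-> | neq_ca] := eqVneq c a; first exact: subsetIl.
  have [-> | neq_cb] := eqVneq c b; first exact: subsetIr.
  (* The three sets have a union of k+2 points, so the union of their images does not have k+1, and
     the images form a sunflower with core [C]. *)
  have [ca cb cc] := And3 (cSx a Sa) (cSx b Sb) (cSx c Sc).
  apply: (@sunflower_core _ k); rewrite ?card_lower ?cU //; try by rewrite eq_sym.
  rewrite card_union_lower // -!setUUl -!setUA !cardsU1 !inE !negb_or.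
  by rewrite neq_ab Sa Sb Sc [a == c]eq_sym neq_ca [b == c]eq_sym neq_cb; lia.
split=> // A cA; apply/idP/idP=> [sCA|]; last exact: sub_C.
(* The converse is by counting: [f] injects the [k]-supersets of [S] into those of [C], which are
   equally many, so [f A] is the image of a superset of [S]. *)
have injK : {in supersets k S &, injective f}.
  move=> B B'; rewrite !inE => /andP[/eqP cB _] /andP[/eqP cB' _].
  exact: inclusion_preserving_inj_lower.
have eqK : f @: supersets k S = supersets k C.
  apply/eqP; rewrite eqEcard card_in_imset // !card_supersets; try lia.
  have -> : #|C| = #|S| by lia.
  rewrite leqnn andbT; apply/subsetP=> _ /imsetP[B + ->].
  by rewrite !inE => /andP[/eqP cB sSB]; rewrite card_lower // eqxx sub_C.
have: f A \in supersets k C by rewrite inE card_lower // eqxx.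
rewrite -eqK => /imsetP[B]; rewrite inE => /andP[/eqP cB sSB].
by move/(inclusion_preserving_inj_lower cA cB) => ->.
Qed.

(** [g] agrees with [f] on [k]-sets and sends each (k-1)-set to its core; the default [set0] is
    never reached at these sizes. *)
Lemma inclusion_preserving_pred : exists2 g : {set T} -> {set T},
  inclusion_preserving k.-1 k g & forall A : {set T}, #|A| = k -> g A = f A.
Proof.
pose P (S C : {set T}) := (#|C|.+1 == k) &&
  [forall A : {set T}, (#|A| == k) ==> ((C \subset f A) == (S \subset A))].
pose g (S : {set T}) := if #|S| == k then f S else odflt set0 [pick C | P S C].
have gE (A : {set T}) : #|A| = k -> g A = f A by rewrite /g => ->; rewrite eqxx.
have gP (S : {set T}) : #|S| = k.-1 -> P S (g S).
  move=> cS; rewrite /g ifF; last by apply/eqP; lia.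
  case: pickP => // noC; have [|C [cC sC]] := @exists_core S; first by lia.
  have /idP[] := noC C; rewrite /P cC eqxx.
  by apply/forallP=> A; apply/implyP=> /eqP/sC->.
exists g => //; split=> [S|A cA|S A].
- by case/gP/andP=> /eqP; lia.
- by rewrite gE // card_lower.
move=> cS cA; have /andP[_ /forallP/(_ A)] := gP S cS.
by rewrite cA eqxx [g A]gE //= => /eqP.
Qed.

(** Each point of [B] lies in a [k]-subset of [B], so [s @: B] is contained in [f B], and the sizes
    agree. *)
Lemma inclusion_preserving_upper (s : {perm T}) :
  (forall A : {set T}, #|A| = k -> f A = s @: A) ->
  forall B : {set T}, #|B| = l -> f B = s @: B.
Proof.
move=> fs B cB; apply/esym/eqP.
rewrite eqEcard card_upper // (card_imset _ (@perm_inj _ s)) cB leqnn andbT.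
apply/subsetP=> _ /imsetP[x Bx ->]; have [A [cA Ax sAB]] := exists_lower cB Bx.
by move: sAB; rewrite -f_sub // fs // => /subsetP; apply; rewrite imset_f.
Qed.

End InclusionPreserving.

(** * Reconstructing the permutation of the ground set *)

Lemma inclusion_preserving_lower1 (T : finType) l (f : {set T} -> {set T}) :
  1 < l < #|T| -> inclusion_preserving 1 l f ->
  exists s : {perm T}, forall A : {set T}, #|A| = 1 -> f A = s @: A.
Proof.
case/andP=> lt1l lt_lT fP; pose s x := odflt x [pick y in f [set x]].
have fs x : f [set x] = [set s x].
  have [f1 _ _] := fP; have /eqP/cards1P[y fx] := f1 [set x] (cards1 x).
  rewrite fx /s; case: pickP => [z|/(_ y)]; rewrite fx inE ?eqxx //.
  by move/eqP->.
have inj_s : injective s.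
  move=> x y eq_s; apply/set1_inj.
  apply: (inclusion_preserving_inj_lower lt1l lt_lT fP); rewrite ?cards1 //.
  by rewrite !fs eq_s.
exists (perm inj_s) => A /eqP/cards1P[x ->].
by rewrite fs imset_set1 permE.
Qed.

Lemma inclusion_preserving_perm (T : finType) k l (f : {set T} -> {set T}) :
  0 < k < l -> l < #|T| -> inclusion_preserving k l f ->
  exists s : {perm T}, forall A : {set T}, (#|A| == k) || (#|A| == l) -> f A = s @: A.
Proof.
move=> /andP[k_gt0 lt_kl] lt_lT fP.
suff [s fs]: exists s : {perm T}, forall A : {set T}, #|A| = k -> f A = s @: A.
  exists s => A /orP[] /eqP; first exact: fs.
  exact: (inclusion_preserving_upper lt_kl fP k_gt0).
(* Both [l] and [f] are generalized, because the descent replaces the sizes (k, l) by (k-1, k) and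
   [f] by [g]. *)
elim: k => // k IHk in l f k_gt0 lt_kl lt_lT fP *.
case: k => [|k] in IHk lt_kl fP k_gt0 *.
  by apply: (inclusion_preserving_lower1 _ fP); rewrite lt_kl.
have [g gP gf] := inclusion_preserving_pred lt_kl lt_lT fP k_gt0.
have lt_kT := ltn_trans lt_kl lt_lT.
have [//|//|//|//|s gs] := IHk k.+2 g.
(* The permutation describes [g] on its lower sets, hence on its upper ones, where [g] equals
   [f]. *)
exists s => A cA; rewrite -gf //.
exact: (inclusion_preserving_upper (ltnSn _) gP).
Qed.

(** * Automorphisms of the inclusion graph and its two parts *)

Section GraphAut.

Variables n k l : nat.
Hypotheses (k_gt0 : 0 < k) (lt_kl : k < l) (lt_ln : l < n).

Local Notation V := (inclusion_vertex n k l).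
Local Notation edge := (@inclusion_graph n k l).
Local Notation Aut := (graph_aut edge).

Let lt_lT : l < #|'I_n|. Proof. by rewrite card_ord. Qed.

Lemma exists_vertex (A : {set 'I_n}) : (#|A| == k) || (#|A| == l) -> exists v : V, val v = A.
Proof. by move=> cA; exists (Sub A cA); rewrite SubK. Qed.

Lemma edge_subset (A B : V) : #|val A| = k -> #|val B| = l -> edge A B = (val A \subset val B).
Proof.
move=> cA cB; rewrite /inclusion_graph.
have -> : A != B by apply/eqP=> eqAB; move: cB lt_kl; rewrite -eqAB cA; lia.
case: (boolP (_ \subset _)) => //= _; apply/negP=> /subset_leq_card.
by rewrite cA cB leqNgt lt_kl.
Qed.

Lemma edge_card (A B : V) : edge A B -> (#|val B| == k) = (#|val A| == l).
Proof.
case/andP=> neqAB sAB.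
have neq_card : #|val A| != #|val B|.
  apply: contra_neq neqAB => eqc; apply/val_inj/eqP.
  by case/orP: sAB => sAB; last rewrite eq_sym; rewrite eqEcard sAB eqc leqnn.
by have := valP A; have := valP B; lia.
Qed.

Lemma exists_lower_vertex : exists A : V, #|val A| = k.
Proof.
have [|A [cA _ _]] := exists_set_between (sub0set [set: 'I_n]) (m := k).
  by rewrite cards0 cardsT (ltnW (ltn_trans lt_kl lt_lT)).
by have [|v vA] := @exists_vertex A; rewrite ?cA ?eqxx //; exists v; rewrite vA.
Qed.

Lemma exists_edge_upper (B : V) : #|val B| = l -> exists2 A : V, edge A B & #|val A| = k.
Proof.
move=> cB; have [|A [cA _ sAB]] := exists_set_between (sub0set (val B)) (m := k).
  by rewrite cards0 cB /= ltnW.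
have [|v vA] := @exists_vertex A; first by rewrite cA eqxx.
by exists v; rewrite ?edge_subset ?vA.
Qed.

Definition preserves_parts (p : {perm V}) := forall A, (#|val (p A)| == k) = (#|val A| == k).

(* Two k-sets differing in one element have a common neighbour, hence their images lie in
   the same part. *)
Lemma aut_lower_lower p (A A' : V) : p \in Aut ->
  #|val A| = k -> #|val A'| = k -> #|val (p A)| = k -> #|val (p A')| = k.
Proof.
move=> /graph_autP autp + cA'.
(* Induction on the distance to [A']: trading a point [a] of [A] for a point [b] of [A'] brings [A]
   closer. *)
have [m] := ubnP #|val A :\: val A'|; elim: m A => // m IHm A; rewrite ltnS => le_m cA cpA.
have [eqD|/set0Pn[a]] := eqVneq (val A :\: val A') set0.
  have sAA' : val A \subset val A' by rewrite -setD_eq0 eqD.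
  suff -> : A' = A by [].
  by apply/val_inj/esym/eqP; rewrite eqEcard sAA' cA cA' leqnn.
rewrite inE => /andP[A'a Aa].
have /set0Pn[b] : val A' :\: val A != set0.
  have := cardsID (val A) (val A'); have := cardsID (val A') (val A).
  have : 0 < #|val A :\: val A'| by apply/card_gt0P; exists a; rewrite inE A'a.
  by rewrite setIC -card_gt0; lia.
rewrite inE => /andP[Ab A'b].
have cC : #|b |: (val A :\ a)| = k.
  rewrite cardsU1 !inE (negPf Ab) andbF add1n.
  by have := cardsD1 a (val A); rewrite cA Aa add1n => /esym.
have [|C vC] := @exists_vertex (b |: (val A :\ a)); first by rewrite cC eqxx.
(* The common neighbour of [A] and [C] is any [l]-set containing [b |: val A], which has k+1
   points. *)
have [||B [cB sAB _]] := @exists_set_between _ (b |: val A) setT l; first exact: subsetT.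
  by rewrite cardsU1 Ab cA add1n lt_kl cardsT ltnW.
have [|w vB] := @exists_vertex B; first by rewrite cB eqxx orbT.
have edgeA : edge A w by rewrite edge_subset ?vB //; apply: subset_trans sAB; apply: subsetUr.
have edgeC : edge C w.
  rewrite edge_subset ?vB ?vC //; apply: subset_trans sAB.
  by rewrite setUS ?subsetDl.
apply: (IHm C); rewrite ?vC //.
  apply: leq_trans le_m; rewrite [X in _ < X](cardsD1 a) inE A'a Aa add1n ltnS.
  apply/subset_leq_card/subsetP=> x; rewrite !inE.
  by case: eqVneq => [->|_] /=; rewrite ?A'b //; case: (x == a); rewrite ?andbF.
have := @edge_card (p w) (p A); rewrite !autp inclusion_graph_sym edgeA cpA eqxx => /(_ isT)/esym/eqP cpw.
by apply/eqP; rewrite (@edge_card (p w)) ?cpw ?eqxx // autp inclusion_graph_sym.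
Qed.

(** One lower vertex staying lower keeps all of them lower; each upper vertex has a lower neighbour,
    so its image is upper. *)
Lemma aut_preserves_parts p (A : V) : p \in Aut ->
  #|val A| = k -> #|val (p A)| = k -> preserves_parts p.
Proof.
move=> autp cA cpA B; have [/eqP cB|cB] := eqVneq #|val B| k.
  by rewrite (aut_lower_lower autp cA (eqP cB) cpA) eqxx.
have {}cB : #|val B| = l by case/orP: (valP B) cB => /eqP-> //; rewrite eqxx.
have [C eBC cC] := exists_edge_upper cB.
have cpC := aut_lower_lower autp cA cC cpA.
have := @edge_card (p B) (p C); rewrite (graph_autP _ _ autp) inclusion_graph_sym eBC cpC eqxx => /(_ isT)/esym/eqP->.
by rewrite gtn_eqF.
Qed.

Lemma vertex_image_subproof (s : 'S_n) (A : V) : (#|s @: val A| == k) || (#|s @: val A| == l).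
Proof. by rewrite (card_imset _ (@perm_inj _ s)) (valP A). Qed.

Definition vertex_image (s : 'S_n) (A : V) : V := Sub (s @: val A) (vertex_image_subproof s A).

Lemma val_vertex_image (s : 'S_n) A : val (vertex_image s A) = s @: val A.
Proof. exact: SubK. Qed.

Lemma vertex_image_inj (s : 'S_n) : injective (vertex_image s).
Proof.
move=> A B /(congr1 val); rewrite !val_vertex_image.
by move/(imset_inj (@perm_inj _ s))/val_inj.
Qed.

Definition vertex_perm (s : 'S_n) : {perm V} := perm (@vertex_image_inj s).

Lemma val_vertex_perm (s : 'S_n) A : val (vertex_perm s A) = s @: val A.
Proof. by rewrite permE val_vertex_image. Qed.

Lemma vertex_permM : {morph vertex_perm : s t / (s * t)%g}.
Proof.
move=> s t; apply/permP=> A; apply/val_inj; rewrite permM !val_vertex_perm -imset_comp.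
by apply: eq_imset => x; rewrite permM.
Qed.

(** If [s] moves [x], a [k]-set containing [x] but not [s x] is not fixed. *)
Lemma vertex_perm_eq1 (s : 'S_n) : vertex_perm s = 1%g -> s = 1%g.
Proof.
move=> s1; apply/permP=> x; rewrite perm1; apply/eqP; apply: contraT => nsx.
have [||A [cA sxA sAx]] := @exists_set_between _ [set x] [set~ s x] k.
- by rewrite sub1set !inE eq_sym.
- by rewrite cards1 k_gt0 cardsC1 card_ord; lia.
have [|v vA] := @exists_vertex A; first by rewrite cA eqxx.
have := val_vertex_perm s v; rewrite s1 perm1 vA => eqA.
have : s x \in A by rewrite eqA imset_f // -sub1set.
by move/(subsetP sAx); rewrite !inE eqxx.
Qed.

Lemma vertex_perm_aut (s : 'S_n) : vertex_perm s \in Aut.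
Proof.
have subE (X Y : {set 'I_n}) : (s @: X \subset s @: Y) = (X \subset Y).
  apply/idP/idP=> [/subsetP sXY|/imsetS//]; apply/subsetP=> x Xx.
  by rewrite -(mem_imset _ _ (@perm_inj _ s)) sXY ?imset_f.
apply/graph_autP=> A B; rewrite /inclusion_graph (inj_eq perm_inj).
by rewrite !val_vertex_perm !subE.
Qed.

Lemma preserves_parts_vertex_perm p :
  p \in Aut -> preserves_parts p -> exists s, p = vertex_perm s.
Proof.
move=> /graph_autP autp parts_p.
(* [p] is extended to all sets by the identity off the vertices. *)
pose f (A : {set 'I_n}) := if insub A is Some v then val (p (v : V)) else A.
have fE (v : V) : f (val v) = val (p v) by rewrite /f valK.
have cpl (v : V) : #|val v| = l -> #|val (p v)| = l.
  move=> cv; have := valP (p v); rewrite parts_p cv.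
  by rewrite gtn_eqF //= => /eqP.
have cpk (v : V) : #|val v| = k -> #|val (p v)| = k by move=> cv; apply/eqP; rewrite parts_p cv.
have fP : inclusion_preserving k l f.
  split=> [A cA|B cB|A B cA cB].
  - have [|v vA] := @exists_vertex A; first by rewrite cA eqxx.
    by rewrite -vA fE cpk // vA.
  - have [|v vB] := @exists_vertex B; first by rewrite cB eqxx orbT.
    by rewrite -vB fE cpl // vB.
  have [|v vA] := @exists_vertex A; first by rewrite cA eqxx.
  have [|w wB] := @exists_vertex B; first by rewrite cB eqxx orbT.
  move: cA cB; rewrite -vA -wB !fE => cv cw.
  by rewrite -(edge_subset (cpk _ cv) (cpl _ cw)) autp edge_subset.
have [|s fs] := inclusion_preserving_perm _ lt_lT fP; first by rewrite k_gt0.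
exists s; apply/permP=> v; apply/val_inj.
by rewrite val_vertex_perm -fE fs // (valP v).
Qed.

Lemma card_edge_lower (A : V) : #|val A| = k -> #|[set B | edge A B]| = 'C(n - k, n - l).
Proof.
move=> cA; have := card_supersets (val A) (ltnW lt_lT); rewrite cA card_ord => <-.
rewrite -(card_imset _ val_inj); apply: eq_card => C.
apply/imsetP/idP=> [[B + ->]|]; rewrite !inE.
  move=> eAB; have := edge_card eAB; rewrite cA (ltn_eqF lt_kl) => /negbT nk.
  have cB : #|val B| = l by case/orP: (valP B) nk => /eqP-> //; rewrite eqxx.
  by rewrite cB eqxx -edge_subset.
case/andP=> /eqP cC sAC; have [|B vB] := @exists_vertex C; first by rewrite cC eqxx orbT.
by exists B; rewrite -?vB // inE edge_subset ?vB.
Qed.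

Lemma card_edge_upper (A : V) : #|val A| = l -> #|[set B | edge A B]| = 'C(l, k).
Proof.
move=> cA; have := cards_draws (val A) k; rewrite cA => <-.
rewrite -(card_imset _ val_inj); apply: eq_card => C.
apply/imsetP/idP=> [[B + ->]|]; rewrite !inE.
  move=> eAB; have := edge_card eAB; rewrite cA eqxx => /eqP cB.
  by rewrite cB eqxx andbT -edge_subset // inclusion_graph_sym.
case/andP=> sAC /eqP cC; have [|B vB] := @exists_vertex C; first by rewrite cC eqxx.
by exists B; rewrite -?vB // inE inclusion_graph_sym edge_subset ?vB.
Qed.

(** Degrees differ: ['C(n - k, l - k)] below and ['C(l, l - k)] above, with [l < n - k]. *)
Lemma aut_card_lower p (A : V) : k + l < n -> p \in Aut -> #|val A| = k -> #|val (p A)| = k.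
Proof.
move=> lt_kln autp cA; case/orP: (valP (p A)) => /eqP cpA; first exact: cpA.
have := card_edge_upper cpA.
have -> : [set B | edge (p A) B] = p @: [set B | edge A B].
  apply/setP=> B; rewrite -[B](permKV p) mem_imset ?inE; last exact: perm_inj.
  by rewrite (graph_autP _ _ autp).
rewrite card_imset ?card_edge_lower //; last exact: perm_inj.
have := @ltn_bin2l l (n - k) (l - k).
rewrite bin_sub ?(ltnW lt_kl) // -[in 'C(n - k, l - k)](bin_sub (n := n - k)); last lia.
by rewrite (_ : n - k - (l - k) = n - l); lia.
Qed.

End GraphAut.

(** * Complementation when k + l = n *)

Section Complement.

Variables n k l : nat.
Hypothesis eq_kln : k + l = n.

Local Notation V := (inclusion_vertex n k l).

Lemma vertex_compl_subproof (A : V) : (#|~: val A| == k) || (#|~: val A| == l).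
Proof. by rewrite cardsCs setCK card_ord; have := valP A; lia. Qed.

Definition vertex_compl (A : V) : V := Sub (~: val A) (vertex_compl_subproof A).

Lemma val_vertex_compl A : val (vertex_compl A) = ~: val A.
Proof. exact: SubK. Qed.

Lemma vertex_compl_inj : injective vertex_compl.
Proof.
by move=> A B /(congr1 val); rewrite !val_vertex_compl => /setC_inj/val_inj.
Qed.

Definition compl_perm : {perm V} := perm vertex_compl_inj.

Lemma val_compl_perm A : val (compl_perm A) = ~: val A.
Proof. by rewrite permE val_vertex_compl. Qed.

Lemma card_compl_perm (A : V) : #|val A| = l -> #|val (compl_perm A)| = k.
Proof. by move=> cA; rewrite val_compl_perm cardsCs setCK card_ord cA; lia. Qed.

Lemma compl_perm2 : (compl_perm ^+ 2 = 1)%g.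
Proof.
by apply/permP=> A; apply/val_inj; rewrite permM perm1 !val_compl_perm setCK.
Qed.

Lemma compl_perm_aut : compl_perm \in graph_aut (@inclusion_graph n k l).
Proof.
apply/graph_autP=> A B; rewrite /inclusion_graph (inj_eq perm_inj).
by rewrite !val_compl_perm !setCS orbC.
Qed.

Lemma commute_compl_vertex_perm (s : 'S_n) : commute compl_perm (vertex_perm k l s).
Proof.
apply/permP=> A; apply/val_inj; rewrite !permM !(val_compl_perm, val_vertex_perm).
apply/setP=> x; rewrite -[x](permKV s) inE !mem_imset ?inE //; exact: perm_inj.
Qed.

End Complement.

(** * Assembling the group isomorphisms *)

Lemma isog_setT (gT rT : finGroupType) (G : {group rT}) (f : gT -> rT) :
  {morph f : x y / (x * y)%g} -> (forall x, f x = 1%g -> x = 1%g) ->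
  (forall x, f x \in G) -> (forall y, y \in G -> exists x, y = f x) -> G \isog [set: gT].
Proof.
move=> fM f1 fG Gf; rewrite isog_sym; apply/isogP.
exists (Morphism (in2W fM : {in [set: gT] &, _})).
  by apply/subsetP=> x /morphpreP[_ /set1P/f1->]; apply/set1P.
apply/setP=> y; apply/morphimP/idP=> [[x _ _ ->]|/Gf[x ->]]; first exact: fG.
by exists x; rewrite ?inE.
Qed.

Theorem theorem1p2 (n k l : nat)
    (hk : 1 <= k) (hkl : k < l) (hln : l <= n - 1) (hkln : k + l <= n) :
  (k + l < n ->
     graph_aut (@inclusion_graph n k l) \isog [set: 'S_n]) /\
  (k + l = n ->
     graph_aut (@inclusion_graph n k l) \isog [set: 'S_n * 'Z_2]).
Proof.
have lt_ln : l < n by lia.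
have [A cA] := exists_lower_vertex hkl lt_ln.
split=> [lt_kln|eq_kln].
  apply: (isog_setT (@vertex_permM n k l)) => [s|s|p autp].
  - exact: vertex_perm_eq1.
  - exact: vertex_perm_aut.
  apply: preserves_parts_vertex_perm => //.
  by apply: (aut_preserves_parts _ _ _ autp cA) => //; apply: aut_card_lower.
pose c := compl_perm eq_kln; pose h := @vertex_perm n k l.
pose f (u : 'S_n * 'Z_2) := (h u.1 * c ^+ u.2)%g.
apply: (isog_setT (f := f)) => [[s i] [t j]|[s i]|[s i]|p autp].
- have -> : f ((s, i) * (t, j))%g = (h (s * t) * c ^+ ((i + j) %% 2))%g by [].
  (* Addition in ['Z_2] is modulo 2, harmless in the exponent since [c] squares to 1. *)
  rewrite expg_mod ?compl_perm2 // expgD /h vertex_permM /f /= !mulgA.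
  congr (_ * _)%g; rewrite -!mulgA; congr (_ * _)%g; apply/commuteX/commute_sym.
  exact: commute_compl_vertex_perm.
- case: i => [[|[|i]] lti] //; rewrite /f /= ?expg0 ?expg1 ?mulg1 => fs1.
    by rewrite (vertex_perm_eq1 hk hkl lt_ln fs1); congr pair; apply/val_inj.
  (* With exponent 1, the [k]-set [A] would be sent to a set of n - k = l points, so the product is
     not the identity. *)
  have cB : #|val (h s A)| = k by rewrite val_vertex_perm card_imset //; apply: perm_inj.
  have := congr1 (fun p : {perm _} => #|val (p A)|) fs1.
  by rewrite permM perm1 val_compl_perm cardsCs setCK card_ord cB cA; lia.
- by rewrite groupM ?groupX ?vertex_perm_aut ?compl_perm_aut.
have [cpA|cpA] := eqVneq #|val (p A)| k.
  have [||s ->] := @preserves_parts_vertex_perm n k l hk hkl lt_ln p.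
  - exact: autp.
  - by move=> B; apply: (aut_preserves_parts _ _ _ autp cA).
  by exists (s, 0%R); rewrite /f /= expg0 mulg1.
have {}cpA : #|val (p A)| = l by case/orP: (valP (p A)) cpA => /eqP-> //; rewrite eqxx.
(* Here [p] moves [A] to the upper part, and following it by [c] brings [A] back to the lower
   one. *)
have autpc : (p * c)%g \in graph_aut (@inclusion_graph n k l) by rewrite groupM ?compl_perm_aut.
have [||s eq_s] := @preserves_parts_vertex_perm n k l hk hkl lt_ln (p * c)%g.
- exact: autpc.
- apply: (aut_preserves_parts _ _ _ autpc cA) => //.
  by rewrite permM card_compl_perm.
exists (s, 1%R); rewrite /f /= /h -eq_s -mulgA.
by rewrite -[(c * _)%g]/(c ^+ 2)%g compl_perm2 mulg1.
Qed.
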